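(* For $n\ge 0$ and $\lambda,\beta,\mu\in C(n)$ define $$A_n(\lambda,\beta)=\chi(\lambda\le\beta)\,L_{\beta,\lambda},\qquad B_n(\beta,\mu)=(-1)^{\ell(\beta)-\ell(\mu)}\chi(\beta\le\mu)\,Z_{\mu,\beta}^{-1}.$$ Then the $C(n)\times C(n)$ matrices $A_n$ and $B_n$ are inverses of each other.
   Context: $C(n)$ is the set of compositions of $n$; $\ell(\alpha)$ is the number of parts and $L(\alpha)$ the last part. For $\alpha,\beta\in C(n)$, $\beta\le\alpha$ ($\beta$ refines $\alpha$) means there exist indices $0=i_0<i_1<\dots<i_{\ell(\alpha)}=\ell(\beta)$ with $\alpha_k=\beta_{i_{k-1}+1}+\dots+\beta_{i_k}$ for all $k$; these indices are then unique, and we set $\beta^{(k)}=(\beta_{i_{k-1}+1},\dots,\beta_{i_k})\in C(\alpha_k)$. For a composition $\gamma=(\gamma_1,\dots,\gamma_s)$, $Z_\gamma=\gamma_1(\gamma_1+\gamma_2)\cdots(\gamma_1+\dots+\gamma_s)$. When $\beta\le\alpha$, define $Z_{\alpha,\beta}=\prod_{k=1}^{\ell(\alpha)}Z_{\beta^{(k)}}$ and $L_{\alpha,\beta}=\prod_{k=1}^{\ell(\alpha)}L(\beta^{(k)})$ (empty products equal 1). $\chi(Q)$ is 1 if $Q$ holds, else 0; entries with $\chi=0$ are $0$. *)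

(* Defs.v *)
From HB Require Import structures.
From mathcomp Require Import all_boot all_order all_algebra.

Set Implicit Arguments.
Unset Strict Implicit.
Unset Printing Implicit Defensive.

Import GRing.Theory.

Definition is_composition (n : nat) (s : seq nat) : bool :=
  all (leq 1) s && (sumn s == n).

Record composition (n : nat) := Composition {
  parts :> seq nat;
  partsP : is_composition n parts
}.

HB.instance Definition _ n := [isSub for @parts n].
HB.instance Definition _ n := [Equality of composition n by <:].
HB.instance Definition _ n := [Choice of composition n by <:].
HB.instance Definition _ n := [Countable of composition n by <:].

(* A composition of n has at most n parts, each of them at most n; this embeds *)
(* composition n into a finite type.                                           *)
Section CompositionFinite.
Variable n : nat.

Lemma parts_gt0 (a : composition n) x : x \in parts a -> 0 < x.
Proof. by case: a => s /= /andP[/allP pos _] /pos. Qed.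

Lemma sumn_parts (a : composition n) : sumn a = n.
Proof. by case: a => s /= /andP[_ /eqP]. Qed.

Lemma size_parts (a : composition n) : size a <= n.
Proof.
rewrite -[leqRHS](sumn_parts a); move: (@parts_gt0 a).
elim: (parts a) => //= x s IHs pos; rewrite -[(size s).+1]add1n leq_add //.
  by rewrite pos ?mem_head.
by apply: IHs => y ys; rewrite pos // inE ys orbT.
Qed.

Lemma parts_leq (a : composition n) x : x \in parts a -> x <= n.
Proof.
rewrite -[leqRHS](sumn_parts a); elim: (parts a) => //= y s IHs.
rewrite inE => /predU1P[->|/IHs/leq_trans]; first exact: leq_addr.
by apply; apply: leq_addl.
Qed.

Definition composition_encode (a : composition n) : {bseq n of 'I_n.+1} :=
  insub_bseq n [seq inord x | x <- parts a].

Definition composition_decode (b : {bseq n of 'I_n.+1}) :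
  option (composition n) := insub [seq val x | x <- b].

Lemma composition_encodeK : pcancel composition_encode composition_decode.
Proof.
move=> a; rewrite /composition_decode.
suff -> : [seq val x | x <- composition_encode a] = parts a by rewrite valK.
rewrite /composition_encode /insub_bseq val_insubd size_map size_parts -map_comp.
by apply: map_id_in => x /parts_leq xn /=; rewrite inordK.
Qed.

HB.instance Definition _ : isFinite (composition n) :=
  PCanIsFinite composition_encodeK.

End CompositionFinite.

(* Indices are 0-based: the sequence gamma_1, ..., gamma_s is                  *)
(* nth 0 gamma 0, ..., nth 0 gamma s.-1.                                       *)
Section Refinement.
Variable n : nat.
Implicit Types a b : composition n.

(* The index sequences 0 = i_0 < i_1 < ... < i_(size a) = size b that witness  *)
(* "b refines a".                                                              *)
Definition is_cut b a (i : {ffun 'I_(size a).+1 -> 'I_(size b).+1}) : bool :=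
  [&& i ord0 == ord0, i ord_max == ord_max &
      [forall k : 'I_(size a),
         (i (inord k) < i (inord k.+1)) &&
         (nth 0 a k == \sum_(i (inord k) <= j < i (inord k.+1)) nth 0 b j)]].

Definition refines b a : bool := [exists i, @is_cut b a i].

(* Only meaningful when b refines a, in which case is_cut_inj below shows that *)
(* it is the only witness.                                                     *)
Definition cut b a : {ffun 'I_(size a).+1 -> 'I_(size b).+1} :=
  odflt [ffun=> ord0] [pick i | @is_cut b a i].

Definition block b a (k : nat) : seq nat :=
  let i := cut b a in
  take (i (inord k.+1) - i (inord k)) (drop (i (inord k)) b).

Lemma is_cut_sum b a (i : {ffun 'I_(size a).+1 -> 'I_(size b).+1}) :
  is_cut i -> forall k, k <= size a ->
  \sum_(0 <= j < i (inord k)) nth 0 b j = \sum_(0 <= j < k) nth 0 a j.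
Proof.
case/and3P=> /eqP i0 _ /forallP ik; elim=> [_|k IHk lt_ka].
  have -> : inord 0 = ord0 :> 'I_(size a).+1 by apply: val_inj; rewrite /= inordK.
  by rewrite i0 !big_geq.
have /andP[lt_i /eqP ak] := ik (Ordinal lt_ka).
rewrite big_nat_recr //= -IHk ?(ltnW lt_ka) // ak.
by rewrite -big_cat_nat // ltnW.
Qed.

Lemma is_cut_inj b a (i i' : {ffun 'I_(size a).+1 -> 'I_(size b).+1}) :
  is_cut i -> is_cut i' -> i = i'.
Proof.
have mono x y : x < y -> y <= size b ->
    \sum_(0 <= j < x) nth 0 b j < \sum_(0 <= j < y) nth 0 b j.
  move=> lt_xy le_yb; rewrite (big_cat_nat _ (ltnW lt_xy)) //=.
  rewrite -[ltnLHS]addn0 ltn_add2l big_ltn // addn_gt0.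
  by rewrite (@parts_gt0 _ b) // mem_nth // (leq_trans lt_xy).
move=> ci ci'; apply/ffunP=> k; apply: val_inj.
have le_k : k <= size a by rewrite -ltnS.
have := etrans (is_cut_sum ci le_k) (esym (is_cut_sum ci' le_k)).
rewrite inord_val /=; case: (ltngtP (i k) (i' k)) => // lt_i eq_s.
  by have := mono _ _ lt_i (leq_ord _); rewrite eq_s ltnn.
by have := mono _ _ lt_i (leq_ord _); rewrite eq_s ltnn.
Qed.

Lemma cutP b a (i : {ffun 'I_(size a).+1 -> 'I_(size b).+1}) :
  is_cut i -> cut b a = i.
Proof.
rewrite /cut; case: pickP => [j cj ci|/(_ i) -> //]; exact: is_cut_inj.
Qed.

End Refinement.

Definition Zc (g : seq nat) : nat :=
  \prod_(j < size g) \sum_(i < j.+1) nth 0 g i.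

(* L(gamma) is only used on nonempty compositions; the default 0 is never      *)
(* reached on the blocks of a refinement.                                      *)
Definition Lc (g : seq nat) : nat := last 0 g.

Definition Zrel n (a b : composition n) : nat :=
  \prod_(k < size a) Zc (block b a k).

Definition Lrel n (a b : composition n) : nat :=
  \prod_(k < size a) Lc (block b a k).

Local Open Scope ring_scope.

Definition entryA n (l b : composition n) : rat :=
  (refines l b)%:R * (Lrel b l)%:R.

(* When b refines m, size m <= size b, so the truncated difference of lengths  *)
(* is the true one.                                                            *)
Definition entryB n (b m : composition n) : rat :=
  (-1) ^+ (size b - size m)%N * (refines b m)%:R * (Zrel m b)%:R^-1.

(* The C(n) x C(n) matrix with entries F, indexed through the enumeration of   *)
(* the finite type composition n.                                              *)
Definition composition_mx n (F : composition n -> composition n -> rat) :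
  'M[rat]_#|{: composition n}| :=
  \matrix_(i, j) F (enum_val i) (enum_val j).

Definition matA n : 'M[rat]_#|{: composition n}| := composition_mx (@entryA n).

Definition matB n : 'M[rat]_#|{: composition n}| := composition_mx (@entryB n).

(* Main.v *)
(** Encode a composition by the set of its nonzero partial sums, so that
    refinement becomes reverse inclusion. For a set D of partial sums let
    gap D t be the distance from t to the largest element of D below t (or to 0).
    If b refines a, then Z_{a,b} is the product over t in D(b) of gap D(a) t and
    L_{a,b} is the product over t in D(a) of gap D(b) t. The (l, m) entry of A B
    is therefore a sum over all sets T between D(m) and D(l) of a product over
    t in T of ratios gap D(l) t / gap D(m) t, with a sign for t outside D(m); it
    factors as the product of these ratios over D(m) times the product of
    1 - gap D(l) t / gap D(m) t over D(l) \ D(m). When l <> m, the factor at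
    the least t in D(l) \ D(m) is 0, because D(l) and D(m) agree below t. *)

Require Import Defs.
From mathcomp Require Import all_boot all_order all_algebra.

Set Implicit Arguments.
Unset Strict Implicit.
Unset Printing Implicit Defensive.

Import GRing.Theory.

(** * Compositions as sets of partial sums *)

Definition psum (s : seq nat) k := \sum_(0 <= j < k) nth 0 s j.

Lemma psum0 s : psum s 0 = 0.
Proof. by rewrite /psum big_geq. Qed.

Lemma psumS s k : psum s k.+1 = psum s k + nth 0 s k.
Proof. by rewrite /psum big_nat_recr. Qed.

Lemma leq_psum s : {homo psum s : k l / k <= l}.
Proof.
by move=> k l le_kl; rewrite /psum [leqRHS](big_cat_nat (leq0n k)) //= leq_addr.
Qed.

Section PartialSums.
Variable n : nat.
Implicit Types a b : composition n.

Lemma psum_ltS a k : k < size a -> psum a k < psum a k.+1.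
Proof.
move=> ka; rewrite psumS -[ltnLHS]addn0 ltn_add2l.
by rewrite (@parts_gt0 _ a) ?mem_nth.
Qed.

Lemma psum_lt a k l : k < l -> l <= size a -> psum a k < psum a l.
Proof.
move=> lt_kl la; apply: leq_trans (psum_ltS _) (leq_psum _ lt_kl).
exact: leq_trans lt_kl la.
Qed.

Lemma psum_inj a k l :
  k <= size a -> l <= size a -> psum a k = psum a l -> k = l.
Proof.
move=> ka la eq_s; case: (ltngtP k l) => // lt.
  by have := psum_lt lt la; rewrite eq_s ltnn.
by have := psum_lt lt ka; rewrite eq_s ltnn.
Qed.

Lemma psum_size a : psum a (size a) = n.
Proof. by rewrite -[RHS](sumn_parts a) sumnE (big_nth 0). Qed.

Lemma psum_leq a k : k <= size a -> psum a k <= n.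
Proof. by move=> ka; rewrite -[leqRHS](psum_size a) leq_psum. Qed.

(* Unlike the usual descent set of a composition, this contains n if n > 0. *)
Definition descents a : {set 'I_n.+1} :=
  [set inord (psum a k.+1) | k : 'I_(size a)].

Lemma descentsP a (t : 'I_n.+1) :
  reflect (exists2 k, k < size a & psum a k.+1 = t) (t \in descents a).
Proof.
apply: (iffP imsetP) => [[k _ ->]|[k ka kt]].
  by exists k => //; rewrite inordK ?ltnS ?psum_leq.
by exists (Ordinal ka) => //=; rewrite kt inord_val.
Qed.

Lemma mem_descents a k : k < size a -> inord (psum a k.+1) \in descents a.
Proof.
by move=> ka; apply/descentsP; exists k; rewrite ?inordK ?ltnS ?psum_leq.
Qed.

Lemma big_descents (R : Type) (idx : R) (op : Monoid.com_law idx) a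
    (F : nat -> R) :
  \big[op/idx]_(t in descents a) F t =
  \big[op/idx]_(0 <= k < size a) F (psum a k.+1).
Proof.
rewrite big_mkord big_imset /= => [|k l _ _ /(congr1 val)]; last first.
  by rewrite /= !inordK ?ltnS ?psum_leq //
    => /(psum_inj (ltn_ord k) (ltn_ord l))[/val_inj].
by apply: eq_bigr => k _; rewrite inordK ?ltnS ?psum_leq.
Qed.

Lemma card_descents a : #|descents a| = size a.
Proof.
by rewrite -sum1_card (big_descents _ _ (fun=> 1)) sum_nat_const_nat subn0 muln1.
Qed.

(** Sorting the set recovers the list of nonzero partial sums, whose successive differences are the
    parts. *)
Lemma descents_inj : injective descents.
Proof.
pose s a := mkseq (fun k => psum a k.+1) (size a).
have s_sorted a : sorted ltn (s a).
  apply/(sortedP 0) => k; rewrite size_mkseq => ka.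
  by rewrite !nth_mkseq ?(ltnW ka) //= psum_lt.
have mem_s a x : x \in s a -> x <= n /\ (inord x : 'I_n.+1) \in descents a.
  by case/mapP=> k; rewrite mem_iota => ka ->; rewrite mem_descents ?psum_leq.
have sub_s a b : descents a = descents b -> {subset s a <= s b}.
  move=> eqD x /mem_s[xn]; rewrite eqD => /descentsP[k kb].
  rewrite inordK // => <-; apply/mapP; exists k => //.
  by rewrite mem_iota.
move=> a b eqD.
have eq_s : s a = s b.
  apply: (irr_sorted_eq ltn_trans ltnn (s_sorted a) (s_sorted b)) => x.
  by apply/idP/idP; apply: sub_s.
have eq_size : size a = size b.
  by have := congr1 size eq_s; rewrite !size_mkseq.
apply/val_inj/(@eq_from_nth _ 0) => //= k ka.
have eq_psumS l : l < size a -> psum a l.+1 = psum b l.+1.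
  by move=> la; have := congr1 (nth 0 ^~ l) eq_s; rewrite !nth_mkseq -?eq_size.
have eq_psum : psum a k = psum b k.
  by case: k ka => [|k] ka; rewrite ?psum0 // eq_psumS // ltnW.
by apply/eqP; rewrite -(eqn_add2l (psum a k)) {2}eq_psum -!psumS eq_psumS.
Qed.

(** The parts of [b] are the differences of consecutive elements of [T], starting from 0. The
    composition [a] serves to put [n] in [T] when [n > 0], so that these differences add up to
    [n]. *)
Lemma descents_surj a (T : {set 'I_n.+1}) :
  descents a \subset T -> ord0 \notin T -> exists b, descents b = T.
Proof.
move=> aT T0; pose l := 0 :: map val (enum T).
have l_sorted : sorted ltn l.
  rewrite /l /= path_min_sorted; last first.
    apply/allP => x /mapP[t]; rewrite mem_enum => tT -> /=.
    by rewrite lt0n; apply: contraNneq T0 => t0;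
      rewrite (_ : ord0 = t) //; apply: val_inj.
  apply: (subseq_sorted ltn_trans (s2 := iota 0 n.+1));
    last exact: iota_ltn_sorted.
  by rewrite -val_enum_ord map_subseq // [X in subseq _ X]enumT filter_subseq.
pose s := mkseq (fun k => nth 0 l k.+1 - nth 0 l k) (size l).-1.
have l_lt k : k < (size l).-1 -> nth 0 l k < nth 0 l k.+1.
  by move=> kl; apply: (sortedP 0 l_sorted).
have psum_s k : k <= size s -> psum s k = nth 0 l k.
  elim: k => [|k IHk] ks; first by rewrite psum0.
  have kl : k < (size l).-1 by rewrite size_mkseq in ks.
  by rewrite psumS (IHk (ltnW ks)) nth_mkseq // subnKC // ltnW // l_lt.
have size_s : size s = #|T| by rewrite size_mkseq /= size_map cardE.
have size_l : (size s).+1 = size l by rewrite size_mkseq.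
have s_n : sumn s = n.
  rewrite sumnE (big_nth 0) -/(psum s _) psum_s //.
  (* For [n = 0] this is the leading 0 of [l]; otherwise [n] is the last partial sum of [a]. *)
  have: n \in l.
    case: (posnP n) => [->|n_gt0]; first exact: mem_head.
    have a_gt0 : 0 < size a.
      by rewrite lt0n; apply: contraTneq n_gt0 => a0;
        rewrite -(psum_size a) a0 psum0.
    rewrite inE; apply/orP; right; apply/mapP; exists ord_max => //.
    rewrite mem_enum (subsetP aT) //; apply/descentsP.
    by exists (size a).-1; rewrite prednK // psum_size.
  have le_l x : x \in l -> x <= n.
    by rewrite inE => /predU1P[->|/mapP[t _ ->]] //; rewrite -ltnS ltn_ord.
  case/(nthP 0) => k; rewrite -size_l ltnS => ks kn.
  apply/eqP; rewrite eqn_leq le_l ?mem_nth -?size_l //=.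
  by rewrite -[leqLHS]kn -!psum_s // leq_psum.
have sP : is_composition n s.
  rewrite /is_composition s_n eqxx andbT; apply/allP => x /mapP[k].
  by rewrite mem_iota => /= kl ->; rewrite subn_gt0 l_lt.
exists (Composition sP); apply/setP => t; apply/descentsP/idP => /=.
  case=> k ks; rewrite psum_s //= => kt.
  have: nth 0 (map val (enum T)) k \in map val (enum T).
    by rewrite mem_nth // size_map -cardE -size_s.
  by rewrite kt mem_map ?mem_enum //; apply: val_inj.
move=> tT; have: val t \in map val (enum T) by rewrite map_f ?mem_enum.
case/(nthP 0) => k; rewrite size_map -cardE -size_s => ks kt.
by exists k => //; rewrite psum_s.
Qed.

(* The empty maximum is 0: below the first element of D, the gap is t itself. *)
Definition gap (D : {set 'I_n.+1}) (t : nat) : nat :=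
  t - \max_(u in D | u < t) u.

(** Here [t] need not be a partial sum of [a]: the product for [Z] takes gaps of the coarser set at
    elements of the finer one. *)
Lemma gap_descents a k t : k < size a -> psum a k < t -> t <= psum a k.+1 ->
  gap (descents a) t = t - psum a k.
Proof.
move=> ka lt_kt le_tk; congr (_ - _); apply/eqP;
  rewrite eqn_leq; apply/andP; split.
  apply/bigmax_leqP => u /andP[/descentsP[l la <-] lt_lt].
  apply: leq_psum; rewrite leqNgt; apply/negP => lt_kl.
  by have := leq_ltn_trans (leq_trans le_tk (leq_psum _ lt_kl)) lt_lt;
    rewrite ltnn.
case: k ka lt_kt {le_tk} => [|k] ka lt_kt; first by rewrite psum0.
have eq_k : (inord (psum a k.+1) : 'I_n.+1) = psum a k.+1 :> nat.
  by rewrite inordK // ltnS psum_leq // ltnW.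
rewrite -[leqLHS]eq_k leq_bigmax_cond //.
by rewrite mem_descents ?eq_k // ltnW.
Qed.

Lemma gap_psumS a k : k < size a -> gap (descents a) (psum a k.+1) = nth 0 a k.
Proof. by move=> ka; rewrite (gap_descents ka) ?psum_ltS // psumS addKn. Qed.

Lemma gap_gt0 a (t : 'I_n.+1) : t \in descents a -> 0 < gap (descents a) t.
Proof.
by case/descentsP => k ka <-; rewrite gap_psumS // (@parts_gt0 _ a) ?mem_nth.
Qed.

(** Conversely to [is_cut_sum], the cut sends [k] to the position in [b] of the [k]-th partial sum
    of [a]; it increases because partial sums do. *)
Lemma refinesE b a : refines b a = (descents a \subset descents b).
Proof.
apply/existsP/subsetP => [[i ci] t /descentsP[k ka kt]|sub].
  have /and3P[_ _ /forallP/(_ (Ordinal ka))/andP[/= lt_i _]] := ci.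
  have i_gt0 := leq_ltn_trans (leq0n _) lt_i.
  apply/descentsP; exists (i (inord k.+1)).-1; rewrite prednK //.
    by rewrite -ltnS ltn_ord.
  by rewrite -kt; apply: is_cut_sum.
have ex_cut (k : 'I_(size a).+1) :
    exists l : 'I_(size b).+1, psum b l == psum a k.
  case: k => -[|k] /= ka; first by exists ord0; rewrite !psum0.
  have /descentsP[l lb] := sub _ (mem_descents ka).
  rewrite inordK ?ltnS ?psum_leq // => eq_l.
  by exists (Ordinal (lb : l.+1 < (size b).+1)); rewrite eq_l.
pose i := [ffun k => xchoose (ex_cut k)].
have iP k : psum b (i k) = psum a k.
  by rewrite ffunE; apply/eqP/(xchooseP (ex_cut k)).
have i_inord k : k <= size a -> psum b (i (inord k)) = psum a k.
  by move=> ka; rewrite iP inordK.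
exists i; apply/and3P; split.
- by apply/eqP/val_inj/(@psum_inj b) => //=; rewrite ?leq_ord // iP /= !psum0.
- apply/eqP/val_inj/(@psum_inj b) => //=; rewrite ?leq_ord // iP /=.
  by rewrite !psum_size.
apply/forallP => k; have ka := ltn_ord k.
have lt_i : i (inord k) < i (inord k.+1).
  rewrite ltnNge; apply/negP => /(leq_psum b).
  by rewrite !i_inord ?(ltnW ka) // leqNgt psum_ltS.
rewrite lt_i /= -(eqn_add2l (psum a k)) -psumS -!i_inord ?(ltnW ka) //.
by rewrite /psum -big_cat_nat // ltnW.
Qed.

End PartialSums.

(** * The products [Z] and [L] as products of gaps *)

Lemma big_nat_telescope (R : Type) (idx : R) (op : Monoid.law idx)
    (f : nat -> nat) (G : nat -> R) m :
  (forall k, k < m -> f k <= f k.+1) ->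
  \big[op/idx]_(0 <= k < m) \big[op/idx]_(f k <= j < f k.+1) G j =
  \big[op/idx]_(f 0 <= j < f m) G j.
Proof.
elim: m => [|m IHm] homo_f; first by rewrite !big_geq.
have homo_m k : k < m -> f k <= f k.+1 by move=> km; rewrite homo_f // leqW.
rewrite big_nat_recr //= IHm // -big_cat_nat ?homo_f //.
(* What remains is [f 0 <= f m], required to concatenate the two ranges. *)
elim: {IHm homo_f} m homo_m => // m IHm homo_m;
  apply: leq_trans (homo_m m _) => //.
by apply: IHm => k km; rewrite homo_m // leqW.
Qed.

Lemma Zc_slice s i j : j <= size s ->
  Zc (take (j - i) (drop i s)) = \prod_(i <= k < j) (psum s k.+1 - psum s i).
Proof.
move=> js; have size_g : size (take (j - i) (drop i s)) = j - i.
  by rewrite size_take_min size_drop (minn_idPl _) // leq_sub2r.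
rewrite /Zc size_g -[X in _ = \prod_(X <= _ < _) _]add0n big_addn big_mkord.
apply: eq_bigr => k _; have le_ik : i <= (k + i).+1 by rewrite -addSn leq_addl.
rewrite {1}/psum (big_cat_nat (leq0n i) le_ik) addKn.
rewrite -[X in _ = \sum_(X <= _ < _) _]add0n big_addn -addSn addnK big_mkord.
apply: eq_bigr => l _; rewrite nth_take ?nth_drop 1?addnC //.
by apply: leq_ltn_trans (ltn_ord k); rewrite -ltnS.
Qed.

Lemma Lc_slice s i j : i < j -> j <= size s ->
  Lc (take (j - i) (drop i s)) = nth 0 s j.-1.
Proof.
move=> ij js; rewrite /Lc -nth_last nth_take.
  rewrite size_take_min size_drop (minn_idPl _) ?leq_sub2r // nth_drop.
  by rewrite -subn1 addnBA ?subn_gt0 // subnKC ?subn1 // ltnW.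
rewrite size_take_min size_drop (minn_idPl _) ?leq_sub2r //.
by rewrite prednK ?subn_gt0.
Qed.

(** Group the elements of [descents b] by block: in block [k], the gap of [descents a] is the
    distance to [psum a k], which is a partial sum of that block. *)
Lemma Zrel_descents n (a b : composition n) : refines b a ->
  Zrel a b = \prod_(t in descents b) gap (descents a) t.
Proof.
case/existsP => i ci; rewrite (big_descents _ _ (gap (descents a))) /Zrel.
have /and3P[/eqP i0 /eqP imax /forallP lt_i] := ci.
have i_inord := is_cut_sum ci.
pose f k := i (inord k) : nat.
have f_lt k : k < size a -> f k < f k.+1.
  by move=> ka; have /andP[] := lt_i (Ordinal ka).
have f0 : f 0 = 0.
  rewrite /f (_ : inord _ = ord0) ?i0 //.
  by apply: val_inj; rewrite /= inordK.
have f_max : f (size a) = size b.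
  rewrite /f (_ : inord _ = ord_max) ?imax //.
  by apply: val_inj; rewrite /= inordK.
transitivity (\prod_(0 <= k < size a) \prod_(f k <= j < f k.+1)
                gap (descents a) (psum b j.+1)); last first.
  by rewrite big_nat_telescope ?f0 ?f_max // => k /f_lt /ltnW.
rewrite big_mkord; apply: eq_bigr => -[k ka] _ /=.
rewrite /block (cutP ci) Zc_slice ?leq_ord //.
rewrite big_nat_cond [RHS]big_nat_cond; apply: eq_bigr => j.
rewrite andbT => /andP[kj jk].
have f_k : psum b (f k) = psum a k by rewrite [LHS]i_inord // ltnW.
rewrite [psum b (i _)]f_k -(@gap_descents _ a k) //.
  by rewrite -f_k psum_lt // (leq_trans jk) // -ltnS ltn_ord.
by rewrite -[psum a k.+1]i_inord // leq_psum.
Qed.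

(** The last part of block [k] is the part of [b] that ends at [psum a k.+1], hence the gap of
    [descents b] there. *)
Lemma Lrel_descents n (a b : composition n) : refines b a ->
  Lrel a b = \prod_(t in descents a) gap (descents b) t.
Proof.
case/existsP => i ci; rewrite (big_descents _ _ (gap (descents b))) /Lrel.
rewrite big_mkord; apply: eq_bigr => -[k ka] _ /=.
have /and3P[_ _ /forallP/(_ (Ordinal ka))/andP[/= lt_i _]] := ci.
have le_i := leq_ord (i (inord k.+1)).
have i_gt0 := leq_ltn_trans (leq0n _) lt_i.
rewrite /block (cutP ci) Lc_slice // -gap_psumS prednK //.
by congr gap; apply: is_cut_sum.
Qed.

Local Open Scope ring_scope.

(** * Entries of the product of the two matrices *)

Section Product.
Variable n : nat.
Implicit Types l m b : composition n.

Definition gap_ratio l m (t : nat) : rat :=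
  (gap (descents l) t)%:R / (gap (descents m) t)%:R.

(** The value 0 discards every [T] not contained in [descents l]; the minus sign is the share of [t]
    in the sign of [entryB]. *)
Definition weight_in l m (t : 'I_n.+1) : rat :=
  if t \in descents l then
    if t \in descents m then gap_ratio l m t else - gap_ratio l m t
  else 0.

Definition weight_out m (t : 'I_n.+1) : rat := (t \notin descents m)%:R.

(** The factor at [t] depends on [T] only through whether [t] is in [T], so the sum over all [T] is
    an expanded product of two-term sums. *)
Definition weight l m (T : {set 'I_n.+1}) : rat :=
  \prod_t (if t \in T then weight_in l m t else weight_out m t).

Lemma weight_neq0 l m (T : {set 'I_n.+1}) :
  weight l m T != 0 -> (descents m \subset T) && (T \subset descents l).
Proof.
move/prodf_neq0 => nz; apply/andP; split; apply/subsetP => t tT.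
  by apply: contraTT (nz t isT) => /negbTE->; rewrite /weight_out tT eqxx.
by apply: contraTT (nz t isT) => /negbTE tl; rewrite tT /weight_in tl eqxx.
Qed.

Lemma entry_mul l m b : entryA l b * entryB b m = weight l m (descents b).
Proof.
rewrite /entryA /entryB; have [lb|/negPf lb] := boolP (refines l b); last first.
  rewrite !mul0r; apply/esym/eqP; apply: contraFT lb.
  by rewrite refinesE => /weight_neq0/andP[].
have [bm|/negPf bm] := boolP (refines b m); last first.
  rewrite mulr0 mul0r mulr0; apply/esym/eqP; apply: contraFT bm.
  by rewrite refinesE => /weight_neq0/andP[].
rewrite mul1r mulr1 (Lrel_descents lb) (Zrel_descents bm) !natr_prod.
rewrite mulrCA -prodf_div; move: lb bm; rewrite !refinesE => lb bm.
(* The sign is spread as one factor -1 for each element of [descents b] outside [descents m]. *)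
have -> : (size b - size m)%N = #|descents b :\: descents m|.
  by rewrite cardsD (setIidPr bm) !card_descents.
rewrite /weight [RHS](bigID (mem (descents b))) /= [X in _ = _ * X]big1 ?mulr1.
  rewrite (big_setID (descents m)) /= [RHS](big_setID (descents m)) /=.
  rewrite (setIidPr bm) mulrCA; congr (_ * _).
    apply: eq_bigr => t tm; have tb := subsetP bm t tm.
    by rewrite tb /weight_in (subsetP lb) // tm.
  rewrite -prodrN; apply: eq_bigr => t /setDP[tb /negPf tm].
  by rewrite tb /weight_in (subsetP lb) // tm.
move=> t tb; rewrite (negPf tb) /weight_out.
by rewrite (contra (subsetP bm t) tb).
Qed.

(* Sets that are not of the form descents b have weight 0. *)
Lemma sum_weight_descents l m :
  \sum_b weight l m (descents b) = \prod_t (weight_in l m t + weight_out m t).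
Proof.
(* The product expands into a sum over all sets [T], and injectivity of [descents] makes the left
   side a sum over its image. *)
rewrite bigA_distr -(big_imset _ (in2W (@descents_inj n))) /=.
rewrite [RHS](bigID (mem (@descents n @: predT))) /=.
rewrite [X in _ = _ + X]big1 ?addr0 //.
move=> T; apply: contraNeq => /weight_neq0/andP[mT Tl].
have T0 : ord0 \notin T.
  apply/negP => /(subsetP Tl)/descentsP[k kl /= k0].
  by have := psum_ltS kl; rewrite k0.
by have [b <-] := descents_surj mT T0; apply: imset_f.
Qed.

(** A gap at [t] depends only on the elements below [t]; membership of [t] in [descents l] makes it
    nonzero. *)
Lemma gap_ratioE l m (t : 'I_n.+1) :
    (forall u : 'I_n.+1, (u < t)%N -> (u \in descents l) = (u \in descents m)) ->
    t \in descents l -> gap_ratio l m t = 1.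
Proof.
move=> eq_lt tl; rewrite /gap_ratio.
have -> : gap (descents m) t = gap (descents l) t.
  congr (_ - _)%N; apply: eq_bigl => u; case: ltnP => [/eq_lt->|] //.
  by rewrite !andbF.
by rewrite divff // Num.Theory.pnatr_eq0 -lt0n gap_gt0.
Qed.

Lemma prod_weight l m :
  \prod_t (weight_in l m t + weight_out m t) = (l == m)%:R.
Proof.
have [->|neq_lm] := eqVneq l m.
  rewrite big1 // => t _; rewrite /weight_in /weight_out.
  by case: ifP => tm; [rewrite tm gap_ratioE //= addr0|rewrite add0r].
apply/eqP/prodf_eq0.
(* At an element of [descents m] outside [descents l], both terms of the factor vanish. *)
have [ml|] := boolP (descents m \subset descents l); last first.
  case/subsetPn => t tm /negPf tl; exists t => //.
  by rewrite /weight_in tl /weight_out tm add0r.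
have [D0|[t0 t0D]] := set_0Vmem (descents l :\: descents m).
  move/eqP: D0; rewrite setD_eq0 => lm; case/eqP: neq_lm; apply: descents_inj.
  by apply/eqP; rewrite eqEsubset lm.
case: (arg_minnP (fun t : 'I_n.+1 => t : nat) t0D)
  => t /setDP[tl /negPf tm] t_min.
exists t => //; rewrite /weight_in /weight_out tl tm gap_ratioE ?addNr // => u ut.
apply/idP/idP => [ul|/(subsetP ml)//]; apply: contraTT ut => um.
by rewrite -leqNgt; apply: t_min; apply/setDP.
Qed.

End Product.

Theorem theorem5p5 (n : nat) :
  matA n *m matB n = 1%:M /\ matB n *m matA n = 1%:M.
Proof.
suff AB : matA n *m matB n = 1%:M by split=> //; apply: mulmx1C.
apply/matrixP => i j; rewrite !mxE -(inj_eq enum_val_inj).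
rewrite -prod_weight -sum_weight_descents.
rewrite [RHS]big_enum_val; apply: eq_bigr => k _.
by rewrite !mxE entry_mul.
Qed.
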